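(* Let $0<\alpha\le\beta$ and $\theta=\beta/\alpha\ge1$. For $\mathbf w=(w_1,w_2,w_3,w_4)\in[\alpha,\beta]^4$ let $v_i=1/w_i$ and $$R_u(\mathbf w)=1-\frac14\left(\frac{v_1+v_2+v_3+v_4}{\max_{\mathbf p\in\Delta}L_{\mathbf v}(\mathbf p)}\right)^{1/3},$$ the relative loss of efficiency of the uniform design $(1/4,1/4,1/4,1/4)$, and let $R^{(u)}_{\max}=\max_{\mathbf w\in[\alpha,\beta]^4}R_u(\mathbf w)$. Then, with $\rho=\sqrt{\theta^2-\theta+1}$, $$R^{(u)}_{\max}=\begin{cases}1-\frac34\left(1+\frac3\theta\right)^{1/3}, & \theta\ge3,\\[2pt] 1-\frac18\left(2(\theta+3)(9-\theta)^2\right)^{1/3}, & \theta_*\le\theta<3,\\[2pt] 1-\frac32\left(\frac{(\theta+1)(\theta-1)^2}{(2\theta-1-\rho)(\theta-2+\rho)(\theta+1+\rho)}\right)^{1/3}, & 1<\theta<\theta_*,\\[2pt] 0, & \theta=1,\end{cases}$$ where $\theta_*\approx1.32$ is the 3rd root of $3456-5184\theta+3561\theta^2+596\theta^3-1506\theta^4+100\theta^5+\theta^6=0$.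
   Context: Setting: a $2^2$ experiment with binary response under a generalized linear model with main-effects linear predictor $\eta=\beta_0+\beta_1x_1+\beta_2x_2$; $w_i>0$ are the GLM weights $(d\mu_i/d\eta_i)^2/(\mu_i(1-\mu_i))$ at the four design points. A design is a vector $\mathbf p$ in the simplex $\Delta=\{p_i\ge0,\ \sum_ip_i=1\}$, and the $D$-criterion equals $16w_1w_2w_3w_4L_{\mathbf v}(\mathbf p)$ with $v_i=1/w_i$ and $$L_{\mathbf v}(\mathbf p)=v_4p_1p_2p_3+v_3p_1p_2p_4+v_2p_1p_3p_4+v_1p_2p_3p_4 .$$ $R_u(\mathbf w)$ equals $1-(\det(\mathbf w,\mathbf p_u)/\det(\mathbf w,\mathbf p_t))^{1/3}$, where $\mathbf p_u$ is the uniform design and $\mathbf p_t$ the $D$-optimal design for $\mathbf w$. *)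

(* Defs.v *)
From HB Require Import structures.
From mathcomp Require Import all_boot all_order all_algebra.
From mathcomp Require Import all_classical all_reals all_analysis.
Set Implicit Arguments. Unset Strict Implicit. Unset Printing Implicit Defensive.
Import Order.TTheory GRing.Theory Num.Theory.
Local Open Scope classical_set_scope.
Local Open Scope ring_scope.

Definition i1 : 'I_4 := @Ordinal 4 0 erefl.
Definition i2 : 'I_4 := @Ordinal 4 1 erefl.
Definition i3 : 'I_4 := @Ordinal 4 2 erefl.
Definition i4 : 'I_4 := @Ordinal 4 3 erefl.

Definition simplex {R : realType} : set ('I_4 -> R) :=
  [set p | (forall i, 0 <= p i) /\ \sum_(i < 4) p i = 1].

Definition Lv {R : realType} (v p : 'I_4 -> R) : R :=
  v i4 * p i1 * p i2 * p i3 + v i3 * p i1 * p i2 * p i4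
  + v i2 * p i1 * p i3 * p i4 + v i1 * p i2 * p i3 * p i4.

(* max_{p in Delta} L_v(p) (the sup is attained: continuous function on a compact set) *)
Definition Lmax {R : realType} (v : 'I_4 -> R) : R :=
  sup [set Lv v p | p in simplex].

Definition Ru {R : realType} (w : 'I_4 -> R) : R :=
  let v := fun i => (w i)^-1 in
  1 - 4^-1 * powR ((\sum_(i < 4) v i) / Lmax v) 3^-1.

Definition box {R : realType} (alpha beta : R) : set ('I_4 -> R) :=
  [set w | forall i, alpha <= w i <= beta].

Definition ptheta {R : realType} (t : R) : R :=
  3456 - 5184 * t + 3561 * t ^+ 2 + 596 * t ^+ 3 - 1506 * t ^+ 4
  + 100 * t ^+ 5 + t ^+ 6.

Definition third_root {R : realType} (ts : R) : Prop :=
  ptheta ts = 0 /\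
  exists r1 r2 : R, r1 < r2 < ts /\ ptheta r1 = 0 /\ ptheta r2 = 0 /\
    (forall r, ptheta r = 0 -> r < ts -> r = r1 \/ r = r2).

Definition Rmax_formula {R : realType} (ts t : R) : R :=
  let rho := Num.sqrt (t ^+ 2 - t + 1) in
  if 3 <= t then 1 - 3 / 4 * powR (1 + 3 / t) 3^-1
  else if ts <= t then 1 - 8^-1 * powR (2 * (t + 3) * (9 - t) ^+ 2) 3^-1
  else if 1 < t then
    1 - 3 / 2 * powR ((t + 1) * (t - 1) ^+ 2 /
       ((2 * t - 1 - rho) * (t - 2 + rho) * (t + 1 + rho))) 3^-1
  else 0.

(* Main.v *)
Require Import Defs.
From HB Require Import structures.
From mathcomp Require Import all_boot all_order all_algebra.
From mathcomp Require Import all_classical all_reals all_analysis.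
From mathcomp Require Import ring lra.
Import Order.TTheory GRing.Theory Num.Theory.
Local Open Scope classical_set_scope.
Local Open Scope ring_scope.
Set Implicit Arguments. Unset Strict Implicit. Unset Printing Implicit Defensive.

(** Maximizing the loss means minimizing [sum v / L_v(p)] over both [v] and [p];
    after rescaling, [v] ranges over [[1, theta]^4]. For fixed [p], the inequality
    [m * L_v(p) <= sum v] is linear in each [v_i], so only the vertices
    [v_i \in {1, theta}] matter, and by symmetry only the number [k] of heavy
    coordinates. For each [k], AM-GM symmetrizes [p] and leaves a cubic in one
    variable. The case [k = 3] is [k = 1] with [theta] replaced by [1 / theta] and
    never wins; comparing [k = 1] with [k = 2] for [theta < 3] involves [rho], and
    squaring it away gives [27 (theta - 1)^4 ptheta(theta)], so the sextic decides
    which one is extremal. Its third root is its only root in [(1, 3)]. *)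

(** * Sharp bounds on the criterion at the vertices of the weight cube *)

Definition crit {K : realFieldType} (v1 v2 v3 v4 p1 p2 p3 p4 : K) : K :=
  v4 * p1 * p2 * p3 + v3 * p1 * p2 * p4 + v2 * p1 * p3 * p4 + v1 * p2 * p3 * p4.

Definition simplex4 {K : realFieldType} (p1 p2 p3 p4 : K) : Prop :=
  [/\ 0 <= p1, 0 <= p2, 0 <= p3 & 0 <= p4] /\ p1 + p2 + p3 + p4 = 1.

(** As [p] runs over the whole simplex, one placement of the heavy weights stands for all others.
    The vertex with four heavy weights follows from the first bound by scaling. *)
Definition vertex_bounds {K : realFieldType} (m t : K) : Prop :=
  forall p1 p2 p3 p4, simplex4 p1 p2 p3 p4 ->
    [/\ m * crit 1 1 1 1 p1 p2 p3 p4 <= 4,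
        m * crit 1 1 1 t p1 p2 p3 p4 <= t + 3,
        m * crit t t 1 1 p1 p2 p3 p4 <= 2 * t + 2 &
        m * crit t t t 1 p1 p2 p3 p4 <= 3 * t + 1].

Section DesignBounds.
Variable K : realFieldType.
Implicit Types t m v p x y z : K.

Lemma elem2_le x y z : 3 * (x * y + x * z + y * z) <= (x + y + z) ^+ 2.
Proof.
have := sqr_ge0 (x - y); have := sqr_ge0 (x - z); have := sqr_ge0 (y - z).
by lra.
Qed.

Lemma elem3_le x y z : 0 <= x -> 0 <= y -> 0 <= z ->
  27 * (x * y * z) <= (x + y + z) ^+ 3.
Proof.
move=> x0 y0 z0.
have := mulr_ge0 x0 (sqr_ge0 (x - y)); have := mulr_ge0 x0 (sqr_ge0 (x - z)).
have := mulr_ge0 x0 (sqr_ge0 (y - z)); have := mulr_ge0 y0 (sqr_ge0 (x - y)).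
have := mulr_ge0 y0 (sqr_ge0 (x - z)); have := mulr_ge0 y0 (sqr_ge0 (y - z)).
have := mulr_ge0 z0 (sqr_ge0 (x - y)); have := mulr_ge0 z0 (sqr_ge0 (x - z)).
have := mulr_ge0 z0 (sqr_ge0 (y - z)).
by lra.
Qed.

(** The criterion is [t * e3 + p4 * e2] in the elementary symmetric functions of [p1, p2, p3], both
    largest at equal arguments for a given sum. *)
Lemma one_heavy_le t p1 p2 p3 p4 : 0 <= t -> simplex4 p1 p2 p3 p4 ->
  27 * crit 1 1 1 t p1 p2 p3 p4 <=
  t * (p1 + p2 + p3) ^+ 3 + 9 * (1 - (p1 + p2 + p3)) * (p1 + p2 + p3) ^+ 2.
Proof.
move=> t0 [[h1 h2 h3 h4] hs].
have -> : 1 - (p1 + p2 + p3) = p4 by lra.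
have := ler_wpM2l t0 (elem3_le h1 h2 h3).
have := ler_wpM2l h4 (elem2_le p1 p2 p3).
by rewrite /crit; lra.
Qed.

Lemma one_heavy_interior t p1 p2 p3 p4 : 0 <= t -> t < 9 -> simplex4 p1 p2 p3 p4 ->
  (9 - t) ^+ 2 * crit 1 1 1 t p1 p2 p3 p4 <= 4.
Proof.
move=> t0 t9 hp; have := one_heavy_le t0 hp.
case: hp => -[h1 h2 h3 h4] _.
have := addr_ge0 (addr_ge0 h1 h2) h3.
set s := p1 + p2 + p3; set c := crit _ _ _ _ _ _ _ _ => s0 hc.
have d0 : 0 <= (9 - t) ^+ 2 by exact: sqr_ge0.
have ds : 0 <= (9 - t) * s by apply: mulr_ge0 => //; lra.
have := ler_wpM2l d0 hc.
(* The cubic in [s] is stationary at [s = 6 / (9 - t)], so its distance to the value there has a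
   double root. *)
have : 0 <= ((9 - t) * s + 3) * ((9 - t) * s - 6) ^+ 2.
  by apply: mulr_ge0 (sqr_ge0 _); lra.
by lra.
Qed.

(** The stationary point has now left the open interval [(0, 1)], and the cubic is largest at
    [s = 1]. The gap is [(t - 3) * (1 - s^3)] plus [3 * (1 - s)^2 * (1 + 2 * s)]. *)
Lemma one_heavy_boundary t p1 p2 p3 p4 : 3 <= t -> simplex4 p1 p2 p3 p4 ->
  27 * crit 1 1 1 t p1 p2 p3 p4 <= t.
Proof.
move=> t3 hp; have t0 : 0 <= t by lra.
have := one_heavy_le t0 hp.
case: hp => -[h1 h2 h3 h4] hs.
have := addr_ge0 (addr_ge0 h1 h2) h3.
have : p1 + p2 + p3 <= 1 by lra.
set s := p1 + p2 + p3 => s1 s0 /le_trans; apply.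
have s3 : 0 <= 1 - s ^+ 3 by rewrite subr_ge0 exprn_ile1.
have t3' : 0 <= t - 3 by lra.
have := mulr_ge0 t3' s3.
have : 0 <= (1 - s) * ((1 - s) * (1 + 2 * s)).
  by apply: mulr_ge0; [lra | apply: mulr_ge0; lra].
by lra.
Qed.

Lemma crit_scale c v1 v2 v3 v4 p1 p2 p3 p4 :
  crit (c * v1) (c * v2) (c * v3) (c * v4) p1 p2 p3 p4 =
  c * crit v1 v2 v3 v4 p1 p2 p3 p4.
Proof. by rewrite /crit; ring. Qed.

Lemma three_heavy t p1 p2 p3 p4 : 1 <= t -> simplex4 p1 p2 p3 p4 ->
  (9 * t - 1) ^+ 2 * crit t t t 1 p1 p2 p3 p4 <= 4 * t ^+ 3.
Proof.
move=> t1 hp.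
have t0 : 0 < t by lra.
have tn0 : t != 0 by rewrite gt_eqF.
have ti0 : 0 <= t^-1 by rewrite invr_ge0 ltW.
have ti9 : t^-1 < 9.
  by rewrite (le_lt_trans (y := 1)) ?invf_le1 //; lra.
have := one_heavy_interior ti0 ti9 hp.
have -> : crit t t t 1 p1 p2 p3 p4 = t * crit 1 1 1 t^-1 p1 p2 p3 p4.
  by rewrite -crit_scale !mulr1 divff.
set c := crit _ _ _ _ _ _ _ _ => hc.
have t3 : 0 <= t ^+ 3 by apply: exprn_ge0; lra.
have := ler_wpM2l t3 hc.
have -> : t ^+ 3 * ((9 - t^-1) ^+ 2 * c) = (9 * t - 1) ^+ 2 * (t * c) by field.
by lra.
Qed.

Lemma prod_le_sqr x y : 4 * (x * y) <= (x + y) ^+ 2.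
Proof. by have := sqr_ge0 (x - y); lra. Qed.

(** The criterion groups as [p1 * p2 * (p3 + p4) + t * p3 * p4 * (p1 + p2)]; AM-GM applies inside
    each pair. *)
Lemma two_heavy_le t p1 p2 p3 p4 : 0 <= t -> simplex4 p1 p2 p3 p4 ->
  4 * crit t t 1 1 p1 p2 p3 p4 <=
  (p1 + p2) * (p3 + p4) * (p1 + p2 + t * (p3 + p4)).
Proof.
move=> t0 [[h1 h2 h3 h4] hs].
have := ler_wpM2l (addr_ge0 h3 h4) (prod_le_sqr p1 p2).
have := ler_wpM2l (mulr_ge0 t0 (addr_ge0 h1 h2)) (prod_le_sqr p3 p4).
by rewrite /crit; lra.
Qed.

(** Bounding [s^2 * (1 - s)] and [s * (1 - s)^2] separately by [4 / 27] avoids rho; this weaker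
    estimate suffices for [3 <= t]. *)
Lemma two_heavy_crude t p1 p2 p3 p4 : 0 <= t -> simplex4 p1 p2 p3 p4 ->
  27 * crit t t 1 1 p1 p2 p3 p4 <= 1 + t.
Proof.
move=> t0 hp; have := two_heavy_le t0 hp.
case: hp => -[h1 h2 h3 h4] hs.
have -> : p3 + p4 = 1 - (p1 + p2) by lra.
have : p1 + p2 <= 1 by lra.
have := addr_ge0 h1 h2.
set s := p1 + p2 => s0 s1 hc.
have A : 0 <= (3 * s - 2) ^+ 2 * (1 + 3 * s).
  by apply: mulr_ge0 (sqr_ge0 _) _; lra.
have B : 0 <= t * ((3 * s - 1) ^+ 2 * (4 - 3 * s)).
  by apply: mulr_ge0 => //; apply: mulr_ge0 (sqr_ge0 _) _; lra.
by lra.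
Qed.

Lemma two_heavy_interior t r p1 p2 p3 p4 :
  1 < t -> 0 <= r -> r ^+ 2 = t ^+ 2 - t + 1 -> simplex4 p1 p2 p3 p4 ->
  108 * (t - 1) ^+ 2 * crit t t 1 1 p1 p2 p3 p4 <=
  (2 * t - 1 - r) * (t - 2 + r) * (t + 1 + r).
Proof.
move=> t1 r0 hr hp; have t0 : 0 <= t by lra.
have := two_heavy_le t0 hp.
case: hp => -[h1 h2 h3 h4] hs.
have -> : p3 + p4 = 1 - (p1 + p2) by lra.
have : p1 + p2 <= 1 by lra.
have := addr_ge0 h1 h2.
set s := p1 + p2; set c := crit _ _ _ _ _ _ _ _ => s0 s1 hc.
have d0 : 0 <= 27 * (t - 1) ^+ 2 by apply: mulr_ge0 (sqr_ge0 _).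
have := ler_wpM2l d0 hc.
(* The gap below has a double root at the stationary point [(2 * t - 1 - r) / (3 * (t - 1))] and a
   simple root at [(2 * t - 1 + 2 * r) / (3 * (t - 1))]. This inequality puts the simple root at or
   beyond [s = 1]. *)
have tr : t - 2 <= 2 * r.
  by rewrite leNgt; apply/negP => h; nra.
have : 0 <= (3 * (t - 1) * s - (2 * t - 1 - r)) ^+ 2 *
            (2 * t - 1 + 2 * r - 3 * (t - 1) * s).
  apply: mulr_ge0 (sqr_ge0 _) _.
  have : 0 <= (t - 1) * (1 - s) by apply: mulr_ge0; lra.
  by lra.
have -> : (3 * (t - 1) * s - (2 * t - 1 - r)) ^+ 2 *
            (2 * t - 1 + 2 * r - 3 * (t - 1) * s) =
  (2 * t - 1 - r) * (t - 2 + r) * (t + 1 + r)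
  - 27 * (t - 1) ^+ 2 * (s * (1 - s) * (s + t * (1 - s))).
  apply/eqP; rewrite -subr_eq0; apply/eqP.
  set u := (X in X = 0).
  have -> : u = (r ^+ 2 - (t ^+ 2 - t + 1)) *
                (3 * r + 9 * (t - 1) * s - 3 * (2 * t - 1)) by rewrite /u; ring.
  by rewrite hr subrr mul0r.
by lra.
Qed.

Lemma linear_ge_vertex b t v : 1 <= v <= t -> b <= b * v \/ b * t <= b * v.
Proof.
move=> /andP[v1 vt]; have [b0|b0] := leP 0 b; [left|right].
  by rewrite ler_peMr.
by rewrite ler_wnM2l // ltW.
Qed.

(** The difference of the two sides is the sum of the [v_i * q_i]. Each term is minimized at an
    endpoint independently of the others, which leaves sixteen vertices. *)
Lemma crit_le_of_vertices m t : vertex_bounds m t -> 0 <= t ->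
  forall v1 v2 v3 v4 p1 p2 p3 p4,
    1 <= v1 <= t -> 1 <= v2 <= t -> 1 <= v3 <= t -> 1 <= v4 <= t ->
    simplex4 p1 p2 p3 p4 ->
    m * crit v1 v2 v3 v4 p1 p2 p3 p4 <= v1 + v2 + v3 + v4.
Proof.
move=> H t0 v1 v2 v3 v4 p1 p2 p3 p4 hv1 hv2 hv3 hv4 [[h1 h2 h3 h4] hs].
(* The first four orders place the singled-out coordinate in each position; with [S1234], the last
   five cover the six choices of a pair. *)
have S1234 : simplex4 p1 p2 p3 p4 by [].
have S1243 : simplex4 p1 p2 p4 p3 by split=> //; lra.
have S1342 : simplex4 p1 p3 p4 p2 by split=> //; lra.
have S2341 : simplex4 p2 p3 p4 p1 by split=> //; lra.
have S1324 : simplex4 p1 p3 p2 p4 by split=> //; lra.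
have S1423 : simplex4 p1 p4 p2 p3 by split=> //; lra.
have S2314 : simplex4 p2 p3 p1 p4 by split=> //; lra.
have S2413 : simplex4 p2 p4 p1 p3 by split=> //; lra.
have S3412 : simplex4 p3 p4 p1 p2 by split=> //; lra.
have [a0 a1 a2 a3] := H _ _ _ _ S1234.
have [_ b1 _ b3] := H _ _ _ _ S1243.
have [_ c1 _ c3] := H _ _ _ _ S1342.
have [_ d1 _ d3] := H _ _ _ _ S2341.
have [_ _ e2 _] := H _ _ _ _ S1324.
have [_ _ f2 _] := H _ _ _ _ S1423.
have [_ _ g2 _] := H _ _ _ _ S2314.
have [_ _ i2 _] := H _ _ _ _ S2413.
have [_ _ j2 _] := H _ _ _ _ S3412.
rewrite /crit in a0 a1 a2 a3 b1 b3 c1 c3 d1 d3 e2 f2 g2 i2 j2 *.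
have a4 : m * t * (p1 * p2 * p3 + p1 * p2 * p4 + p1 * p3 * p4 + p2 * p3 * p4)
   <= 4 * t by have := ler_wpM2l t0 a0; lra.
pose q1 := 1 - m * (p2 * p3 * p4); pose q2 := 1 - m * (p1 * p3 * p4).
pose q3 := 1 - m * (p1 * p2 * p4); pose q4 := 1 - m * (p1 * p2 * p3).
have := linear_ge_vertex q1 hv1; have := linear_ge_vertex q2 hv2.
have := linear_ge_vertex q3 hv3; have := linear_ge_vertex q4 hv4.
rewrite /q1 /q2 /q3 /q4.
by move=> [k4|k4] [k3|k3] [k2|k2] [k1|k1]; lra.
Qed.

End DesignBounds.

(** * Monotonicity and location of the roots of the sextic *)

Section ThresholdPolynomial.
Variable R : realType.
Implicit Types t x y : R.

(** Around 1 the divided difference is a combination of the complete homogeneous polynomials [h_k]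
    in [a, b]. On [[0, 2]] the negative part [106 * h4 + h5] is at most [872 * h2], far below
    [4408 * h2]. *)
Lemma ptheta_decr x y : 1 <= x -> x < y -> y <= 3 -> ptheta y < ptheta x.
Proof.
move=> x1 xy y3; rewrite -subr_gt0.
pose a := x - 1; pose b := y - 1.
have a0 : 0 <= a by rewrite /a; lra.
have b0 : 0 < b by rewrite /b; lra.
have ab : 0 <= a * b by exact: mulr_ge0 a0 (ltW b0).
have a2 : 0 <= 2 - a by rewrite /a; lra.
have b2 : 0 <= 2 - b by rewrite /b; lra.
pose h2 := a ^+ 2 + a * b + b ^+ 2.
pose h3 := a ^+ 3 + a ^+ 2 * b + a * b ^+ 2 + b ^+ 3.
pose h4 := a ^+ 4 + a * b * h2 + b ^+ 4.
pose h5 := a ^+ 5 + a * b * h3 + b ^+ 5.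
have -> : ptheta x - ptheta y = (y - x) *
   (1792 + 2672 * (a + b) + 4408 * h2 + 991 * h3 - 106 * h4 - h5).
  by rewrite /ptheta /h5 /h4 /h3 /h2 /a /b; ring.
apply: mulr_gt0; first by lra.
clearbody a b.
have h2_ge0 : 0 <= h2 by rewrite /h2 !addr_ge0 ?exprn_ge0 // ltW.
have h3_ge0 : 0 <= h3.
  by rewrite /h3 !addr_ge0 ?mulr_ge0 ?exprn_ge0 // ltW.
have a22 : a ^+ 2 <= 4 by have := mulr_ge0 a0 a2; lra.
have b22 : b ^+ 2 <= 4 by have := mulr_ge0 (ltW b0) b2; lra.
have ab4 : a * b <= 4 by have := sqr_ge0 (a - b); lra.
have h4_le : h4 <= 8 * h2.
  have := ler_wpM2l (sqr_ge0 a) a22; have := ler_wpM2l (sqr_ge0 b) b22.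
  by have := ler_wpM2r h2_ge0 ab4; rewrite /h4 /h2; lra.
have h3_le : h3 <= 4 * h2.
  have := mulr_ge0 (sqr_ge0 a) a2; have := mulr_ge0 (sqr_ge0 b) b2.
  have := mulr_ge0 ab a2; have := mulr_ge0 ab b2.
  have := sqr_ge0 a; have := sqr_ge0 b.
  by rewrite /h3 /h2; lra.
have h5_le : h5 <= 24 * h2.
  have := ler_wpM2r h3_ge0 ab4.
  have E8 : 8 = 2 ^+ 3 :> R by ring.
  have a3 : a ^+ 3 <= 8 by rewrite E8; apply: lerXn2r; rewrite ?nnegrE //; lra.
  have b3 : b ^+ 3 <= 8 by rewrite E8; apply: lerXn2r; rewrite ?nnegrE //; lra.
  have := ler_wpM2l (sqr_ge0 a) a3; have := ler_wpM2l (sqr_ge0 b) b3.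
  have := sqr_ge0 a; have := sqr_ge0 b.
  by move: h3_le; rewrite /h5 /h3 /h2; lra.
by lra.
Qed.

Lemma ptheta_gt0_01 t : 0 <= t -> t <= 1 -> 0 < ptheta t.
Proof.
move=> t0 t1; have t1' : 0 <= 1 - t by lra.
have t20 := sqr_ge0 t; have t30 := exprn_ge0 3 t0.
have := mulr_ge0 t20 t1'; have := mulr_ge0 t30 t1'.
have := exprn_ge0 5 t0; have := exprn_ge0 6 t0.
have := sqr_ge0 (t - 1).
by rewrite /ptheta; lra.
Qed.

(** The quotient [ptheta (- z) / z^3] is strictly decreasing on [(0, 60]], so it vanishes at most
    once; [hb] controls its only growing term [z^3]. *)
Lemma ptheta_no_pair_near x y : 0 < x -> x < y -> y <= 60 ->
  ptheta (- x) = 0 -> ptheta (- y) = 0 -> False.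
Proof.
move=> x0 xy y60 hx hy; have y0 : 0 < y by lra.
have xy0 : 0 < x * y by exact: mulr_gt0.
have h2_gt0 : 0 < x ^+ 2 + x * y + y ^+ 2 by rewrite !addr_gt0 ?exprn_gt0.
have hs := mulr_gt0 xy0 (addr_gt0 x0 y0).
have h0 := sqr_ge0 (x * y).
have x60 : 0 <= x * (60 - x) by apply: mulr_ge0; lra.
have y60' : 0 <= y * (60 - y) by apply: mulr_ge0; lra.
have xy60 : 0 <= x * (60 - y) by apply: mulr_ge0; lra.
have hb : 0 <= 1506 + 100 * (x + y) - (x ^+ 2 + x * y + y ^+ 2) by lra.
have := mulr_ge0 (exprn_ge0 3 (ltW xy0)) hb.
set e := _ * (1506 + _ - _) => e0.
have yx : 0 < y - x by lra.
have F0 : 0 < 3456 * (x ^+ 2 + x * y + y ^+ 2) + 5184 * (x * y * (x + y))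
   + 3561 * (x * y) ^+ 2 + e by lra.
have := mulr_gt0 yx F0.
have -> : (y - x) * (3456 * (x ^+ 2 + x * y + y ^+ 2) + 5184 * (x * y * (x + y))
   + 3561 * (x * y) ^+ 2 + e) = y ^+ 3 * ptheta (- x) - x ^+ 3 * ptheta (- y).
  by rewrite /ptheta /e; ring.
by rewrite hx hy !mulr0 subr0 ltxx.
Qed.

(** Here [ptheta (- z) / z^5] is strictly increasing for [60 <= z], the leading term [z]
    dominating. *)
Lemma ptheta_no_pair_far x y : 60 <= x -> x < y ->
  ptheta (- x) = 0 -> ptheta (- y) = 0 -> False.
Proof.
move=> x60 xy hx hy.
have x0 : 0 <= x by lra.
have y0 : 0 <= y by lra.
have u0 := mulr_ge0 x0 y0.
pose h2 := x ^+ 2 + x * y + y ^+ 2.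
pose h3 := (x + y) * (x ^+ 2 + y ^+ 2).
pose h4 := x ^+ 4 + x * y * h2 + y ^+ 4.
have y10 : 0 <= y ^+ 2 - 100 by rewrite subr_ge0; nra.
have x10 : 0 <= x ^+ 2 - 100 by rewrite subr_ge0; nra.
have h2_ge0 : 0 <= h2 by rewrite /h2 !addr_ge0 ?exprn_ge0.
have h2_le : 10 * h2 <= (x * y) ^+ 2.
  have := mulr_ge0 (sqr_ge0 x) y10; have := mulr_ge0 (sqr_ge0 y) x10.
  by have := sqr_ge0 (x - y); have := sqr_ge0 (x + y); rewrite /h2; lra.
have h3_le : 10 * h3 <= (x * y) ^+ 3.
  have s_le : x + y <= x * y.
    have x1 : 0 <= x - 2 by lra.
    have y1 : 0 <= y - 2 by lra.
    by have := mulr_ge0 x1 y1; lra.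
  have q_le : 10 * (x ^+ 2 + y ^+ 2) <= (x * y) ^+ 2.
    by move: h2_le; rewrite /h2; lra.
  have q0 : 0 <= 10 * (x ^+ 2 + y ^+ 2).
    by have := sqr_ge0 x; have := sqr_ge0 y; lra.
  have := ler_pM (addr_ge0 x0 y0) q0 s_le q_le.
  by rewrite /h3 -exprS; lra.
have h4_le : 10 * h4 <= (x * y) ^+ 4.
  have h22 : 0 <= 10 * h2 by lra.
  have := ler_pM h22 h22 h2_le h2_le.
  have q0 := addr_ge0 (sqr_ge0 x) (sqr_ge0 y).
  have := mulr_ge0 u0 q0; have := exprn_ge0 4 x0; have := exprn_ge0 4 y0.
  by have := sqr_ge0 (x * y); rewrite /h4 /h2; lra.
have yx : 0 < y - x by lra.
have F0 : 0 < (x * y) ^+ 5 + 1506 * (x * y) ^+ 4 + 596 * ((x * y) ^+ 3 * (x + y))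
   - 3561 * ((x * y) ^+ 2 * h2) - 5184 * (x * y * h3) - 3456 * h4.
  have := ler_wpM2l (sqr_ge0 (x * y)) h2_le.
  have := ler_wpM2l u0 h3_le.
  have := mulr_ge0 (exprn_ge0 3 u0) (addr_ge0 x0 y0).
  have := exprn_ge0 5 u0.
  have : 0 < (x * y) ^+ 4 by apply/exprn_gt0/mulr_gt0; lra.
  clearbody h2 h3 h4.
  by lra.
have := mulr_gt0 yx F0.
have -> : (y - x) * ((x * y) ^+ 5 + 1506 * (x * y) ^+ 4
   + 596 * ((x * y) ^+ 3 * (x + y))
   - 3561 * ((x * y) ^+ 2 * h2) - 5184 * (x * y * h3) - 3456 * h4) =
  x ^+ 5 * ptheta (- y) - y ^+ 5 * ptheta (- x).
  by rewrite /ptheta /h4 /h3 /h2; ring.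
by rewrite hx hy !mulr0 subr0 ltxx.
Qed.

Lemma ptheta_ivt x y : x <= y -> ptheta x * ptheta y <= 0 ->
  exists2 z, x <= z <= y & ptheta z = 0.
Proof.
move=> xy hxy.
have hornerE7 (c0 c1 c2 c3 c4 c5 c6 z : R) :
  (Poly [:: c0; c1; c2; c3; c4; c5; c6]).[z] = c0 + c1 * z + c2 * z ^+ 2
    + c3 * z ^+ 3 + c4 * z ^+ 4 + c5 * z ^+ 5 + c6 * z ^+ 6.
  by rewrite horner_Poly /=; ring.
pose P : {poly R} := Poly [:: 3456; - 5184; 3561; 596; - 1506; 100; 1].
have PE z : P.[z] = ptheta z by rewrite /P hornerE7 /ptheta; ring.
have [h|h] := leP (ptheta x) 0; have [k|k] := leP (ptheta y) 0.
- have [x0|x0] := eqVneq (ptheta x) 0; first by exists x; rewrite ?lexx.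
  exists y; rewrite ?lexx ?xy //; apply/eqP; rewrite eq_le k /=.
  by have : ptheta x < 0 by [rewrite lt_neqAle x0]; nra.
- have [|z hz /rootP] := @poly_ivt R P x y xy; first by rewrite !PE h ltW.
  by rewrite PE => ?; exists z.
- have [|z hz /rootP] := @poly_ivt R (- P) x y xy.
    by rewrite !hornerN !PE oppr_le0 oppr_ge0 k ltW.
  by rewrite hornerN PE => /eqP; rewrite oppr_eq0 => /eqP ?; exists z.
- by have := mulr_gt0 h k; lra.
Qed.

(** If [ts] were negative, two of [r1, r2, ts] would lie on the same side of -60, which the two
    preceding exclusions forbid. *)
Lemma third_root_bounds (ts : R) : third_root ts -> 1 < ts /\ ts < 3.
Proof.
move=> [h0 [r1 [r2 [/andP[r12 r2t] [h1 [h2 hr]]]]]].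
have ts0 : 0 <= ts.
  rewrite leNgt; apply/negP => tsn.
  have [r2l|r2l] := leP r2 (- 60).
    by apply: (@ptheta_no_pair_far (- r2) (- r1)); rewrite ?opprK //; lra.
  by apply: (@ptheta_no_pair_near (- ts) (- r2)); rewrite ?opprK //; lra.
have ts1 : 1 < ts.
  by rewrite ltNge; apply/negP => /(ptheta_gt0_01 ts0); rewrite h0 ltxx.
split=> //; rewrite ltNge; apply/negP => ts3.
(* Sign changes give three distinct roots below 3, too many if [3 <= ts]. *)
have [||a /andP[_ a3] ha] := @ptheta_ivt (- 120) (- 3).
- by lra.
- by rewrite /ptheta; lra.
have [||b /andP[b3 b1] hb] := @ptheta_ivt (- 3) (- 1).
- by lra.
- by rewrite /ptheta; lra.
have [||c /andP[c1 c2] hc] := @ptheta_ivt 1 2.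
- by lra.
- by rewrite /ptheta; lra.
have ab : a < b.
  rewrite lt_neqAle (le_trans a3 b3) andbT; apply/eqP => E.
  have E3 : a = - 3 by lra.
  by move: ha; rewrite E3 /ptheta; lra.
have bc : b < c by lra.
have cts : c < ts by lra.
have bts : b < ts by lra.
have ats : a < ts by lra.
by case: (hr a ha ats) => ?; case: (hr b hb bts) => ?; case: (hr c hc cts) => ?; lra.
Qed.

End ThresholdPolynomial.

(* Four times [sum v / max_p L_v(p)] at [v = (1, 1, 1, t)] with [t <= 3]. *)
Definition one_heavy_ratio {K : realFieldType} (t : K) : K :=
  (t + 3) * (9 - t) ^+ 2.

(* [108 * (t - 1) ^+ 2 * max_p L_v(p)] at [v = (t, t, 1, 1)], with [r] for rho. *)
Definition rho_prod {K : realFieldType} (t r : K) : K :=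
  (2 * t - 1 - r) * (t - 2 + r) * (t + 1 + r).

Definition ratio_gap {K : realFieldType} (t : K) : K :=
  864 * ((t + 1) * (t - 1) ^+ 2) -
  one_heavy_ratio t * ((2 * t - 1) * (t - 2) * (t + 1)).

(** * One against two heavy coordinates, decided by the sextic *)

Section ThresholdComparison.
Variable R : realType.
Implicit Types t r m : R.

(** The terms in [r^2] cancel and the linear one merges with the cubic, so one squaring will remove
    the radical. *)
Lemma rho_prodE t r : r ^+ 2 = t ^+ 2 - t + 1 ->
  rho_prod t r = (2 * t - 1) * (t - 2) * (t + 1) + 2 * r ^+ 3.
Proof.
move=> hr.
have -> : rho_prod t r = (2 * t - 1) * (t - 2) * (t + 1) + 2 * r ^+ 3
   - 3 * r * (r ^+ 2 - (t ^+ 2 - t + 1)) by rewrite /rho_prod; ring.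
by rewrite hr subrr mulr0 subr0.
Qed.

(* After clearing denominators, comparing [k = 1] with [k = 2] amounts to comparing
   [ratio_gap t] with [2 * one_heavy_ratio t * r ^+ 3]; squaring removes the radical. *)
Lemma sqr_gap t r : r ^+ 2 = t ^+ 2 - t + 1 ->
  (2 * one_heavy_ratio t * r ^+ 3) ^+ 2 - ratio_gap t ^+ 2 = 27 * ((t - 1) ^+ 4 * ptheta t).
Proof.
move=> hr.
have -> : (2 * one_heavy_ratio t * r ^+ 3) ^+ 2 = 4 * one_heavy_ratio t ^+ 2 * (r ^+ 2) ^+ 3 by ring.
by rewrite hr /ratio_gap /one_heavy_ratio /ptheta; ring.
Qed.

(** The winner is the vertex with the smaller ratio; the sign of [ptheta t] selects it through
    [sqr_gap]. *)
Lemma two_heavy_wins t r : 0 <= t -> 0 <= r -> r ^+ 2 = t ^+ 2 - t + 1 ->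
  0 <= ptheta t -> 864 * ((t + 1) * (t - 1) ^+ 2) <= one_heavy_ratio t * rho_prod t r.
Proof.
move=> t0 r0 hr hp.
have g0 : 0 <= one_heavy_ratio t by rewrite /one_heavy_ratio; apply: mulr_ge0 (sqr_ge0 _); lra.
have l0 : 0 <= 2 * one_heavy_ratio t * r ^+ 3 
  by apply: mulr_ge0 (exprn_ge0 3 r0); apply: mulr_ge0 g0; lra.
have qs : ratio_gap t ^+ 2 <= (2 * one_heavy_ratio t * r ^+ 3) ^+ 2.
  rewrite -subr_ge0 (sqr_gap hr); apply: mulr_ge0; first by lra.
  by apply: mulr_ge0 => //; rewrite exprn_even_ge0.
have : ratio_gap t <= 2 * one_heavy_ratio t * r ^+ 3.
  rewrite -(ger0_norm l0) (le_trans (ler_norm _)) //.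
  by rewrite -ler_sqr ?nnegrE // !real_normK ?num_real.
by rewrite (rho_prodE hr) /ratio_gap; lra.
Qed.

Lemma one_heavy_wins t r : 1 <= t -> t <= 3 -> 0 <= r ->
  r ^+ 2 = t ^+ 2 - t + 1 ->
  ptheta t <= 0 -> one_heavy_ratio t * rho_prod t r <= 864 * ((t + 1) * (t - 1) ^+ 2).
Proof.
move=> t1 t3 r0 hr hp.
have g0 : 0 <= one_heavy_ratio t by rewrite /one_heavy_ratio; apply: mulr_ge0 (sqr_ge0 _); lra.
have l0 : 0 <= 2 * one_heavy_ratio t * r ^+ 3 
  by apply: mulr_ge0 (exprn_ge0 3 r0); apply: mulr_ge0 g0; lra.
(* Taking square roots in this direction requires a nonnegative gap, seen by expanding at
   [t = 1]. *)
have q0 : 0 <= ratio_gap t.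
  pose d := t - 1.
  have d0 : 0 <= d by rewrite /d; lra.
  have d2 : 0 <= 2 - d by rewrite /d; lra.
  have -> : ratio_gap t = 512 + 768 * d + 936 * d ^+ 2 + 318 * d ^+ 3 + 39 * d ^+ 4
     + 17 * d ^+ 5 + 2 * (d ^+ 5 * (2 - d)) by rewrite /ratio_gap /one_heavy_ratio /d; ring.
  have := mulr_ge0 (exprn_ge0 5 d0) d2; have := exprn_ge0 5 d0.
  have := exprn_ge0 4 d0; have := exprn_ge0 3 d0; have := exprn_ge0 2 d0.
  by clearbody d; lra.
have qs : (2 * one_heavy_ratio t * r ^+ 3) ^+ 2 <= ratio_gap t ^+ 2.
  rewrite -subr_le0 (sqr_gap hr).
  have : (t - 1) ^+ 4 * ptheta t <= 0.
    by apply: mulr_ge0_le0 => //; rewrite exprn_even_ge0.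
  by lra.
have : 2 * one_heavy_ratio t * r ^+ 3 <= ratio_gap t.
  by move: qs; rewrite ler_sqr ?nnegrE.
by rewrite (rho_prodE hr) /ratio_gap; lra.
Qed.

End ThresholdComparison.

(** * The minimal ratio, its attainment and the closed formula *)

Section ExtremalRatio.
Variable R : realType.
Implicit Types ts t r m a c k l b v p y : R.

(** Together with [vertex_bounds m t] and [0 < m], this makes [m] the minimum of the ratio. *)
Definition ratio_attained m t : Prop :=
  exists v1 v2 v3 v4 p1 p2 p3 p4,
    [/\ 1 <= v1 <= t, 1 <= v2 <= t, 1 <= v3 <= t & 1 <= v4 <= t] /\
    simplex4 p1 p2 p3 p4 /\
    v1 + v2 + v3 + v4 <= m * crit v1 v2 v3 v4 p1 p2 p3 p4.

Lemma scaled_le m c k l b : 0 <= m -> 0 < k ->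
  k * c <= l -> m * l <= b * k -> m * c <= b.
Proof.
move=> m0 k0 kc ml; rewrite -(ler_pM2r k0) (le_trans _ ml) //.
by rewrite -mulrA ler_wpM2l // mulrC.
Qed.

Lemma balanced_le m p1 p2 p3 p4 : 0 <= m -> m <= 64 -> simplex4 p1 p2 p3 p4 ->
  m * crit 1 1 1 1 p1 p2 p3 p4 <= 4.
Proof.
move=> m0 m64 hp.
have h : (9 - 1 : R) ^+ 2 * crit 1 1 1 1 p1 p2 p3 p4 <= 4.
  by apply: one_heavy_interior => //; lra.
by apply: (scaled_le m0 _ h); lra.
Qed.

(** The gap is [(t - 1)^2 * (13 - t)]; hence four equal weights, with ratio 64, never beat one heavy
    weight. *)
Lemma one_heavy_ratio_le t : 1 <= t -> t <= 3 -> one_heavy_ratio t <= 4 * 64.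
Proof.
move=> t1 t3; have t12 : 0 <= 13 - t by lra.
by have := mulr_ge0 (sqr_ge0 (t - 1)) t12; rewrite /one_heavy_ratio; lra.
Qed.

(** After division by [t^3] the right side is [one_heavy_ratio] at [1 / t]; the difference of the
    sides has the factor [(t - 1)^3]. *)
Lemma three_heavy_loses t : 1 <= t -> t <= 3 ->
  one_heavy_ratio t * t ^+ 3 <= (3 * t + 1) * (9 * t - 1) ^+ 2.
Proof.
move=> t1 t3; have t3' : 0 <= 3 - t by lra.
have d3 : 0 <= (t - 1) ^+ 3 by apply: exprn_ge0; lra.
have q0 : 0 <= - 1 + 12 * t + 12 * t ^+ 2 - t ^+ 3.
  by have := mulr_ge0 (sqr_ge0 t) t3'; have := sqr_ge0 t; lra.
by have := mulr_ge0 d3 q0; rewrite /one_heavy_ratio; lra.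
Qed.

(** Staying below the one-heavy ratio settles 0, 1 and 3 heavy weights, so only the two-heavy bound
    is left as input. *)
Lemma vertex_bounds_below3 m t : 1 < t -> t <= 3 -> 0 <= m ->
  4 * m <= one_heavy_ratio t ->
  (forall p1 p2 p3 p4, simplex4 p1 p2 p3 p4 ->
    m * crit t t 1 1 p1 p2 p3 p4 <= 2 * t + 2) ->
  vertex_bounds m t.
Proof.
move=> t1 t3 m0 mg h2 p1 p2 p3 p4 hp; split.
- have := one_heavy_ratio_le (ltW t1) t3.
  by move=> g64; apply: balanced_le => //; lra.
- have h : (9 - t) ^+ 2 * crit 1 1 1 t p1 p2 p3 p4 <= 4.
    by apply: one_heavy_interior => //; lra.
  apply: (scaled_le m0 _ h); first by apply: exprn_gt0; lra.
  by move: mg; rewrite /one_heavy_ratio; lra.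
- exact: h2.
- have h := three_heavy (ltW t1) hp.
  apply: (scaled_le m0 _ h); first by apply: exprn_gt0; lra.
  have t30 : 0 <= t ^+ 3 by apply: exprn_ge0; lra.
  have := ler_wpM2r t30 mg; have := three_heavy_loses (ltW t1) t3.
  by lra.
Qed.

Lemma two_heavy_bound m t r : 1 < t -> 0 <= r -> r ^+ 2 = t ^+ 2 - t + 1 ->
  0 <= m -> m * rho_prod t r <= 216 * ((t + 1) * (t - 1) ^+ 2) ->
  forall p1 p2 p3 p4, simplex4 p1 p2 p3 p4 ->
    m * crit t t 1 1 p1 p2 p3 p4 <= 2 * t + 2.
Proof.
move=> t1 r0 hr m0 hm p1 p2 p3 p4 hp.
have h := two_heavy_interior t1 r0 hr hp.
apply: (scaled_le m0 _ h).
  by apply: mulr_gt0; [lra | apply: exprn_gt0; lra].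
by move: hm; rewrite /rho_prod; lra.
Qed.

Lemma vertex_bounds_above3 t : 3 <= t -> vertex_bounds (27 * (1 + 3 / t)) t.
Proof.
move=> t3 p1 p2 p3 p4 hp.
have t0 : 0 < t by lra.
have tn0 : t != 0 by rewrite gt_eqF.
set m := 27 * (1 + 3 / t).
have mt : m * t = 27 * (t + 3) by rewrite /m; field.
have m0 : 0 <= m by rewrite -(pmulr_lge0 _ t0) mt; lra.
(* The crude two-heavy bound needs exactly [m / 27 <= 2]. *)
have m54 : m <= 54 by rewrite -(ler_pM2r t0) mt; lra.
split.
- by apply: balanced_le => //; lra.
- by apply: (scaled_le m0 _ (one_heavy_boundary t3 hp)); rewrite ?mt; lra.
- apply: (scaled_le m0 _ (two_heavy_crude (ltW t0) hp)); first by lra.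
  by have := @ler_wpM2r _ (1 + t) _ _ _ m54; lra.
- have t1 : 1 <= t by lra.
  apply: (scaled_le m0 _ (three_heavy t1 hp)); first by apply: exprn_gt0; lra.
  have -> : m * (4 * t ^+ 3) = 4 * t ^+ 2 * (m * t) by ring.
  rewrite mt.
  have t30 : 0 <= t - 3 by lra.
  have := mulr_ge0 (sqr_ge0 t) t30; have := mulr_ge0 (ltW t0) t30.
  by lra.
Qed.

Lemma ratio_attained_above3 t : 3 <= t -> ratio_attained (27 * (1 + 3 / t)) t.
Proof.
move=> t3; have t0 : 0 < t by lra.
have tn0 : t != 0 by rewrite gt_eqF.
exists 1, 1, 1, t, 3^-1, 3^-1, 3^-1, 0.
split; first by split; lra.
split; first by split; [split; lra | lra].
suff -> : 27 * (1 + 3 / t) * crit 1 1 1 t 3^-1 3^-1 3^-1 0 = t + 3 by lra.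
by rewrite /crit; field.
Qed.

Lemma ratio_attained_one_heavy t : 1 <= t -> t < 3 ->
  ratio_attained (one_heavy_ratio t / 4) t.
Proof.
move=> t1 t3; have d0 : 0 < 9 - t by lra.
have dn0 : 9 - t != 0 by rewrite gt_eqF.
(* The maximizing mass [s = 6 / (9 - t)] is split equally over three points. *)
exists 1, 1, 1, t, (2 / (9 - t)), (2 / (9 - t)), (2 / (9 - t)), ((3 - t) / (9 - t)).
split; first by split; lra.
split.
  split; last by field.
  by split; apply: divr_ge0; lra.
rewrite [X in _ <= X](_ : _ = t + 3); first by lra.
by rewrite /crit /one_heavy_ratio; field.
Qed.

Lemma ratio_attained_two_heavy t r : 1 < t -> 0 < 2 * t - 1 - r ->
  0 < t - 2 + r -> 0 < t + 1 + r ->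
  ratio_attained (216 * ((t + 1) * (t - 1) ^+ 2) / rho_prod t r) t.
Proof.
move=> t1 a0 b0 c0; have d0 : 0 < t - 1 by lra.
have dn0 : t - 1 != 0 by rewrite gt_eqF.
have an0 : 2 * t - 1 - r != 0 by rewrite gt_eqF.
have bn0 : t - 2 + r != 0 by rewrite gt_eqF.
have cn0 : t + 1 + r != 0 by rewrite gt_eqF.
(* Here [2 * x] is the stationary point of the two-heavy cubic, and [2 * y] is the remaining
   mass. *)
pose x := (2 * t - 1 - r) / (6 * (t - 1)).
pose y := (t - 2 + r) / (6 * (t - 1)).
exists t, t, 1, 1, x, x, y, y.
split; first by split; lra.
split.
  split; last by rewrite /x /y; field.
  by split; apply: divr_ge0; lra.
rewrite [X in _ <= X](_ : _ = 2 * t + 2); first by lra.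
rewrite /crit /rho_prod /x /y; field.
by rewrite an0 bn0 cn0 dn0.
Qed.

Lemma rho_factors_gt0 t r : 1 < t -> 0 <= r -> r ^+ 2 = t ^+ 2 - t + 1 ->
  [/\ 0 < 2 * t - 1 - r, 0 < t - 2 + r & 0 < t + 1 + r].
Proof.
move=> t1 r0 hr; split; last by lra.
  by rewrite ltNge; apply/negP => h; nra.
by rewrite ltNge; apply/negP => h; nra.
Qed.

Lemma cube_root_scale a y : 0 <= a -> 0 <= y ->
  a * powR y 3^-1 = powR (a ^+ 3 * y) 3^-1.
Proof.
move=> a0 y0; rewrite powRM ?exprn_ge0 //; congr (_ * _).
by rewrite -powR_mulrn // -powRrM mulfV ?powRr1 // pnatr_eq0.
Qed.

(** Every branch is [1 - m^(1/3) / 4]: relative to 1/4 the outer factors are 3, 1/2, 6, whose cubes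
    27, 1/8, 216 enter [m]. The last branch has [m = 64]. *)
Lemma Rmax_formula_ratio ts t : third_root ts -> 1 <= t ->
  exists m, [/\ 0 < m, Rmax_formula ts t = 1 - 4^-1 * powR m 3^-1,
    vertex_bounds m t & ratio_attained m t].
Proof.
move=> hts t1; have [ts1 ts3] := third_root_bounds hts; have [hts0 _] := hts.
pose r := Num.sqrt (t ^+ 2 - t + 1).
have r0 : 0 <= r by exact: sqrtr_ge0.
have hr : r ^+ 2 = t ^+ 2 - t + 1 by rewrite sqr_sqrtr //; nra.
rewrite /Rmax_formula -/r; have [t3|t3] := leP 3 t.
  have t0 : 0 < t by lra.
  have q0 : 0 < 3 / t by apply: divr_gt0; lra.
  exists (27 * (1 + 3 / t)); split.
  - by lra.
  - rewrite !cube_root_scale; try lra.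
    by congr (1 - powR _ _); lra.
  - exact: vertex_bounds_above3.
  - exact: ratio_attained_above3.
have [tst|tst] := leP ts t.
  have t1' : 1 < t by lra.
  have g0 : 0 < one_heavy_ratio t.
    by rewrite /one_heavy_ratio; apply: mulr_gt0; [lra | apply: exprn_gt0; lra].
  have hp : ptheta t <= 0.
    have [->|tnts] := eqVneq t ts; first by rewrite hts0.
    have tst' : ts < t by rewrite lt_neqAle eq_sym tnts.
    have := ptheta_decr (ltW ts1) tst' (ltW t3).
    by rewrite hts0; exact: ltW.
  exists (one_heavy_ratio t / 4); split.
  - by lra.
  - rewrite !cube_root_scale; try (rewrite -/(one_heavy_ratio t); lra).
      by congr (1 - powR _ _); rewrite /one_heavy_ratio; lra.
    by move: g0; rewrite /one_heavy_ratio; lra.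
  - apply: vertex_bounds_below3; try lra.
    apply: (two_heavy_bound t1' r0 hr); first by lra.
    by have := one_heavy_wins t1 (ltW t3) r0 hr hp; lra.
  - exact: ratio_attained_one_heavy.
have [t1'|t1'] := ltP 1 t.
  have hp : 0 <= ptheta t.
    by have := ptheta_decr t1 tst (ltW ts3); rewrite hts0; exact: ltW.
  have [a0 b0 c0] := rho_factors_gt0 t1' r0 hr.
  have P0 : 0 < rho_prod t r by rewrite /rho_prod !mulr_gt0.
  have Pn0 : rho_prod t r != 0 by rewrite gt_eqF.
  have n0 : 0 < (t + 1) * (t - 1) ^+ 2.
    by apply: mulr_gt0; [lra | apply: exprn_gt0; lra].
  have q0 := divr_gt0 n0 P0.
  set m := 216 * ((t + 1) * (t - 1) ^+ 2) / rho_prod t r.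
  have m0 : 0 < m by rewrite /m -mulrA; lra.
  have mP : m * rho_prod t r = 216 * ((t + 1) * (t - 1) ^+ 2).
    by rewrite /m divfK.
  exists m; split=> //.
  - rewrite -/(rho_prod t r) !cube_root_scale; try lra.
    by congr (1 - powR _ _); rewrite /m; lra.
  - apply: vertex_bounds_below3; try lra.
      rewrite -(ler_pM2r P0) -mulrA mP.
      by have := @two_heavy_wins _ t r _ r0 hr hp; lra.
    by apply: (two_heavy_bound t1' r0 hr); [exact: ltW | rewrite mP lexx].
  - exact: ratio_attained_two_heavy.
have {t1 t1'} -> : t = 1 by apply/eqP; rewrite eq_le t1 t1'.
exists 64; split.
- by lra.
- rewrite cube_root_scale; try lra.
  rewrite (_ : _ * _ = 1) ?powR1 ?subrr //; lra.
- move=> p1 p2 p3 p4 hp.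
  have h : 64 * crit 1 1 1 1 p1 p2 p3 p4 <= 4 by apply: balanced_le => //; lra.
  by split; lra.
- exists 1, 1, 1, 1, 4^-1, 4^-1, 4^-1, 4^-1.
  split; first by split; lra.
  by split; [split; [split; lra | lra] | rewrite /crit; lra].
Qed.

End ExtremalRatio.

(** * From scalar coordinates to designs and the relative loss *)

Lemma forall_ord4 (P : 'I_4 -> Prop) :
  P i1 -> P i2 -> P i3 -> P i4 -> forall i, P i.
Proof.
move=> h1 h2 h3 h4 [[|[|[|[|//]]]] hi].
- by rewrite (_ : Ordinal hi = i1) //; exact: val_inj.
- by rewrite (_ : Ordinal hi = i2) //; exact: val_inj.
- by rewrite (_ : Ordinal hi = i3) //; exact: val_inj.
- by rewrite (_ : Ordinal hi = i4) //; exact: val_inj.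
Qed.

Lemma sum_ord4 (K : nmodType) (f : 'I_4 -> K) :
  \sum_(i < 4) f i = f i1 + f i2 + f i3 + f i4.
Proof.
rewrite !big_ord_recr big_ord0 /= add0r.
by congr (f _ + f _ + f _ + f _); exact: val_inj.
Qed.

Definition vec4 {K : Type} (a b c d : K) (i : 'I_4) : K := nth a [:: a; b; c; d] i.

Section Efficiency.
Variable R : realType.
Implicit Types (alpha beta m t : R) (w v p : 'I_4 -> R).

Lemma simplex_simplex4 p : simplex p -> simplex4 (p i1) (p i2) (p i3) (p i4).
Proof. by case=> h0; rewrite sum_ord4 => h1; split. Qed.

Lemma simplex_vec4 (p1 p2 p3 p4 : R) :
  simplex4 p1 p2 p3 p4 -> simplex (vec4 p1 p2 p3 p4).
Proof.
move=> [[h1 h2 h3 h4] hs]; split; last by rewrite sum_ord4.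
exact: forall_ord4.
Qed.

(** Both sides are homogeneous of degree one in [v], so scaling by [beta] moves the inverse weights
    into [[1, t]]. *)
Lemma Lv_le m t beta v : 0 < beta -> 1 <= t -> vertex_bounds m t ->
  (forall i, 1 <= beta * v i <= t) ->
  forall p, simplex p -> m * Lv v p <= \sum_(i < 4) v i.
Proof.
move=> b0 t1 hm hv p /simplex_simplex4 hp.
have t0 : 0 <= t by lra.
have := crit_le_of_vertices hm t0 (hv i1) (hv i2) (hv i3) (hv i4) hp.
rewrite crit_scale sum_ord4 -!mulrDr mulrCA ler_pM2l //.
Qed.

(** The assumed inequality bounds the value set, so the supremum is genuine; the uniform design
    shows that it is positive. *)
Lemma Lmax_bounds m v : 0 < m -> (forall i, 0 < v i) ->
  (forall p, simplex p -> m * Lv v p <= \sum_(i < 4) v i) ->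
  [/\ 0 < Lmax v, m * Lmax v <= \sum_(i < 4) v i &
      forall p, simplex p -> Lv v p <= Lmax v].
Proof.
move=> m0 hv hm.
have ub : ubound [set Lv v p | p in simplex] ((\sum_(i < 4) v i) / m).
  by move=> _ [p hp <-]; rewrite ler_pdivlMr // mulrC; exact: hm.
have le_max p : simplex p -> Lv v p <= Lmax v.
  by move=> hp; apply: ub_le_sup; [exists ((\sum_(i < 4) v i) / m) | exists p].
have hu : simplex (vec4 4^-1 4^-1 4^-1 4^-1 : 'I_4 -> R).
  by apply: simplex_vec4; split; [split; lra | lra].
split=> //.
  apply: lt_le_trans (le_max _ hu).
  by rewrite /Lv /vec4 /= !addr_gt0 // !mulr_gt0 // invr_gt0.
rewrite mulrC -ler_pdivlMr //; apply: ge_sup => //.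
by exists (Lv v (vec4 4^-1 4^-1 4^-1 4^-1)), (vec4 4^-1 4^-1 4^-1 4^-1).
Qed.

End Efficiency.

Unset Implicit Arguments.

Theorem theorem4 (R : realType) (alpha beta ts : R) :
  0 < alpha -> alpha <= beta -> third_root ts ->
  let theta := beta / alpha in
  (exists2 w, box alpha beta w & Ru w = Rmax_formula ts theta) /\
  (forall w, box alpha beta w -> Ru w <= Rmax_formula ts theta).
Proof.
move=> a0 ab hts theta.
have b0 : 0 < beta by exact: lt_le_trans ab.
have an0 : alpha != 0 by rewrite gt_eqF.
have bn0 : beta != 0 by rewrite gt_eqF.
have th1 : 1 <= theta by rewrite ler_pdivlMr // mul1r.
have [m [m0 -> hv [v1 [v2 [v3 [v4 [p1 [p2 [p3 [p4 [hvs [hp att]]]]]]]]]]]] :=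
  Rmax_formula_ratio hts th1.
have Lbounds w : box alpha beta w ->
  [/\ 0 < Lmax (fun i => (w i)^-1),
      m * Lmax (fun i => (w i)^-1) <= \sum_(i < 4) (w i)^-1 &
      forall p, simplex p -> Lv (fun i => (w i)^-1) p <= Lmax (fun i => (w i)^-1)].
  move=> hw.
  have w0 i : 0 < w i by have /andP[h _] := hw i; exact: lt_le_trans h.
  apply: Lmax_bounds => //; first by move=> i; rewrite invr_gt0.
  apply: (Lv_le b0 th1 hv) => i; have /andP[h1 h2] := hw i.
  by rewrite ler_pdivlMr // mul1r h2 /= ler_pM2l // lef_pV2 ?posrE.
have upper w : box alpha beta w -> Ru w <= 1 - 4^-1 * powR m 3^-1.
  move=> hw; have [L0 mL _] := Lbounds w hw.
  rewrite /Ru /= lerD2l lerN2 ler_pM2l ?invr_gt0 //.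
  have mle : m <= (\sum_(i < 4) (w i)^-1) / Lmax (fun i => (w i)^-1).
    by rewrite ler_pdivlMr.
  apply: ge0_ler_powR => //; rewrite ?invr_ge0 // ?nnegrE ?ltW //.
  exact: lt_le_trans mle.
split=> //.
(* Undoing the scaling: the inverse weights are [v_i / beta], so the extremal vertex is hit. *)
pose w := vec4 (beta / v1) (beta / v2) (beta / v3) (beta / v4).
have inv_box v : 1 <= v <= theta -> alpha <= beta / v <= beta.
  move=> /andP[h1 h2]; have v0 : 0 < v by lra.
  apply/andP; split; first by rewrite ler_pdivlMr // mulrC -ler_pdivlMr.
  by rewrite ler_pdivrMr // ler_peMr // ltW.
have hw : box alpha beta w.
  by case: hvs => *; apply: forall_ord4; exact: inv_box.
exists w => //; apply/eqP; rewrite eq_le upper //=.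
have [L0 mL maxL] := Lbounds w hw.
rewrite /Ru /= lerD2l lerN2 ler_pM2l ?invr_gt0 //.
have mle : (\sum_(i < 4) (w i)^-1) / Lmax (fun i => (w i)^-1) <= m.
  rewrite ler_pdivrMr //.
  (* Any design bounds [Lmax] from below; the extremal [p] already gives the required value. *)
  apply: le_trans (ler_wpM2l (ltW m0) (maxL _ (simplex_vec4 hp))).
  have bvK v : beta * (beta / v)^-1 = v by rewrite invf_div mulrCA divff ?mulr1.
  have LE : beta * Lv (fun i => (w i)^-1) (vec4 p1 p2 p3 p4) =
            crit v1 v2 v3 v4 p1 p2 p3 p4.
    rewrite -[Lv _ _]/(crit (beta / v1)^-1 (beta / v2)^-1 (beta / v3)^-1
      (beta / v4)^-1 p1 p2 p3 p4) -crit_scale.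
    by rewrite !bvK.
  have SE : beta * \sum_(i < 4) (w i)^-1 = v1 + v2 + v3 + v4.
    by rewrite sum_ord4 !mulrDr /w /vec4 /= !bvK.
  by rewrite -(ler_pM2l b0) SE mulrCA LE.
apply: ge0_ler_powR => //; rewrite ?invr_ge0 ?nnegrE ?(ltW m0) //.
apply: divr_ge0; last exact: ltW.
by apply: le_trans mL; rewrite mulr_ge0 ?ltW.
Qed.
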